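(* Let $G$ be a non-regular bipartite graph of order $m$ with a bipartition such that, within each of the two partite sets, all vertices have the same degree. Let $H$ be a $2t$-regular graph of order $n$ that admits a neighborhood balanced coloring and that admits a local distance antimagic labeling. Then $\chi_{ld}(G[H])\leq 2\,\chi_{ld}(H)$.
   Context: All graphs are finite, simple, undirected and without isolated vertices. For a graph $G$ of order $n$ and a bijection $f\colon V(G)\to\{1,2,\dots,n\}$, the weight of a vertex $u$ is $w_f(u)=\sum_{x\in N(u)}f(x)$, where $N(u)$ is the open neighborhood of $u$. The bijection $f$ is a local distance antimagic labeling of $G$ if $w_f(u)\neq w_f(v)$ for every edge $uv$ of $G$. The local distance antimagic chromatic number $\chi_{ld}(G)$ is the minimum number of distinct weights over all local distance antimagic labelings of $G$ (an upper bound on $\chi_{ld}$ includes the assertion that such a labeling exists). A neighborhood balanced coloring of a graph is an assignment of one of two colors to each vertex (not necessarily proper) such that every vertex has equally many neighbors of each color. The lexicographic product (composition) $G[H]$ has vertex set $V(G)\times V(H)$, with $(g,h)$ and $(g',h')$ adjacent iff either $gg'\in E(G)$, or $g=g'$ and $hh'\in E(H)$. *)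

(* Defs.v *)
From mathcomp Require Import all_boot.
Set Implicit Arguments.
Unset Strict Implicit.
Unset Printing Implicit Defensive.

(* A graph is given by its adjacency relation; isolated vertices are excluded
   from the outset, for all graphs considered. *)
Definition is_graph (T : finType) (e : rel T) : Prop :=
  [/\ symmetric e, irreflexive e & forall u, exists v, e u v].

Section Graph.
Variables (T : finType) (e : rel T).

Definition degree (u : T) : nat := #|[set v | e u v]|.

Definition regular (d : nat) : Prop := forall u, degree u = d.

(* The two partite sets are A and its complement. *)
Definition bipartition (A : {set T}) : Prop :=
  forall u v, e u v -> (u \in A) != (v \in A).

Definition same_degree_on (A : {set T}) : Prop :=
  {in A &, forall u v, degree u = degree v}.

Definition neighborhood_balanced (c : T -> bool) : Prop :=
  forall u, #|[set v | e u v & c v]| = #|[set v | e u v & ~~ c v]|.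

(* A labeling takes values in 'I_n, n the order of the graph; the label of u,
   in {1, ..., n}, is the successor of f u. *)
Definition label (f : {ffun T -> 'I_#|T|}) (u : T) : nat := (f u).+1.

Definition weight (f : {ffun T -> 'I_#|T|}) (u : T) : nat :=
  \sum_(v | e u v) label f v.

Definition local_distance_antimagic (f : {ffun T -> 'I_#|T|}) : bool :=
  [&& injectiveb f, [forall i, i \in codom f]
    & [forall u, forall v, e u v ==> (weight f u != weight f v)]].

Definition num_weights (f : {ffun T -> 'I_#|T|}) : nat :=
  size (undup [seq weight f u | u : T]).

Definition has_lda_labeling : Prop := exists f, local_distance_antimagic f.

(* The value 0 is a placeholder when no labeling exists, so an upper bound is
   only meaningful together with has_lda_labeling. *)
Definition chi_ld : nat :=
  if [pick f | local_distance_antimagic f] is Some f0 then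
    num_weights [arg min_(f < f0 | local_distance_antimagic f) num_weights f]
  else 0.

Lemma chi_ldP : has_lda_labeling ->
  (exists2 f, local_distance_antimagic f & num_weights f = chi_ld) /\
  (forall f, local_distance_antimagic f -> chi_ld <= num_weights f).
Proof.
move=> [g Hg]; rewrite /chi_ld; case: pickP => [f0 Hf0|/(_ g)]; last by rewrite Hg.
by case: arg_minnP => // f Hf le_f; split; first exists f.
Qed.

End Graph.

Definition lexprod (V W : finType) (eG : rel V) (eH : rel W) : rel (V * W) :=
  fun p q => eG p.1 q.1 || (p.1 == q.1) && eH p.2 q.2.

Lemma lexprod_graph (V W : finType) (eG : rel V) (eH : rel W) :
  is_graph eG -> is_graph eH -> is_graph (lexprod eG eH).
Proof.
move=> [sG iG nG] [sH iH nH]; split.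
- by move=> p q; rewrite /lexprod sG eq_sym sH.
- by move=> p; rewrite /lexprod iG iH andbF.
- by move=> [g h]; have [h' hh'] := nH h; exists (g, h'); rewrite /lexprod eqxx hh' orbT.
Qed.

(* Main.v *)
(* Let f be an optimal labeling of H, c the balanced coloring and i the index
   of g in V(G).  Label (g, h) by the i-th number of the h-th block of m
   consecutive numbers, read upwards if c h and downwards otherwise.  By balance,
   the neighbors of (g, h) in its own copy of H contribute an amount P h, affine
   in the weight of h and independent of g; double counting over a copy then
   shows that all copies have the same sum S, so (g, h) has weight
   deg g * S + P h.  Edges of G join vertices of different degrees, and
   0 < P h <= S, so the two degree classes never share a weight. *)
Require Import Defs.
From mathcomp Require Import all_boot.
From mathcomp Require Import zify.
Set Implicit Arguments.
Unset Strict Implicit.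
Unset Printing Implicit Defensive.

Lemma weight_lexprod (V W : finType) (eG : rel V) (eH : rel W)
    (f : {ffun V * W -> 'I_#|{: V * W}|}) (g : V) (h : W) :
  irreflexive eG ->
  weight (lexprod eG eH) f (g, h) =
    \sum_(g' | eG g g') \sum_h' label f (g', h')
    + \sum_(h' | eH h h') label f (g, h').
Proof.
move=> irrG; rewrite /weight /lexprod big_mkcond /=.
pose F g' h' :=
  if eG g g' || (g == g') && eH h h' then label f (g', h') else 0.
rewrite (eq_bigr (fun p => F p.1 p.2)) => [|[]//]; rewrite -(pair_bigA _ F) /F.
rewrite [LHS](bigID (eG g)) /=; congr (_ + _).
  by apply: eq_bigr => g' ->.
(* Irreflexivity puts [g] among its own non-neighbors, and it is the only one of them whose copy
   contributes. *)
rewrite (bigD1 g) ?irrG //= [X in _ + X]big1 ?addn0; last first.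
  move=> g' /andP[/negPf-> g'g]; apply: big1 => h' _.
  by rewrite eq_sym (negPf g'g).
by rewrite [RHS]big_mkcond /=; apply: eq_bigr => h' _; rewrite eqxx.
Qed.

Section ZigzagLabeling.
Variables (V W : finType) (c : W -> bool) (f : {ffun W -> 'I_#|W|}).

Definition zigzag_rank (g : V) (h : W) : 'I_#|V| :=
  if c h then enum_rank g else rev_ord (enum_rank g).

Lemma zigzag_subproof (p : V * W) :
  f p.2 * #|V| + zigzag_rank p.1 p.2 < #|{: V * W}|.
Proof.
rewrite card_prod [X in _ < X]mulnC.
apply: (@leq_trans ((f p.2).+1 * #|V|)); last by rewrite leq_mul2r ltn_ord orbT.
by rewrite mulSn addnC ltn_add2r ltn_ord.
Qed.

Definition zigzag : {ffun V * W -> 'I_#|{: V * W}|} :=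
  [ffun p => Ordinal (zigzag_subproof p)].

(** Division by [#|V|] recovers [f h], hence [h]; with [h] known, the reading direction is fixed and
    the remainder determines [g]. *)
Lemma zigzag_inj : injective f -> injective zigzag.
Proof.
move=> f_inj [g h] [g' h'] /(congr1 val); rewrite !ffunE /= => E.
have V_gt0 : 0 < #|V| by apply: leq_ltn_trans (ltn_ord (enum_rank g)).
have hh' : h = h'.
  apply/f_inj/val_inj; move: (congr1 (divn^~ #|V|) E).
  by rewrite /= !divnMDl // !divn_small ?addn0 // ltn_ord.
rewrite -{h'}hh' in E *; congr pair; move/addnI/val_inj: E; rewrite /zigzag_rank.
by case: (c h) => [|/rev_ord_inj] /enum_rank_inj.
Qed.

(** With [i] the rank of [g], balance gives [t] neighbors of [h] with offset [i] and [t] with offset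
    [#|V| - 1 - i], so [g] cancels from the sum. The term [2 * t * #|V|] arises because blocks are
    numbered from 0 and labels from 1; it stands on the left to avoid truncated subtraction. *)
Lemma zigzag_copy_weight (eH : rel W) (t : nat) (g : V) (h : W) :
  regular eH (2 * t) -> neighborhood_balanced eH c ->
  \sum_(h' | eH h h') label zigzag (g, h') + 2 * t * #|V| =
  #|V| * weight eH f h + t * #|V|.+1.
Proof.
move=> regH balH.
have sum_label (P : pred W) (F : W -> nat) : \sum_(h' | P h') (F h').+1 =
    \sum_(h' | P h') F h' + #|[set h' | P h']|.
  by rewrite -sum1dep_card -big_split; apply: eq_bigr => h' _; rewrite /= addn1.
have cardc : #|[set v | eH h v & c v]| = t /\ #|[set v | eH h v & ~~ c v]| = t.
  have := regH h; rewrite /degree -(cardsID [set v | c v]) => E.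
  have E1 : [set v | eH h v] :&: [set v | c v] = [set v | eH h v & c v].
    by apply/setP => v; rewrite !inE.
  have E2 : [set v | eH h v] :\: [set v | c v] = [set v | eH h v & ~~ c v].
    by apply/setP => v; rewrite !inE andbC.
  move: E; rewrite E1 E2 -(balH h) addnn -mul2n => /eqP.
  by rewrite eqn_pmul2l // => /eqP.
have rank_sum : (\sum_(h' | eH h h') zigzag_rank g h') + t = t * #|V|.
  rewrite (bigID c) /= (eq_bigr (fun=> nat_of_ord (enum_rank g))); last first.
    by move=> h' /andP[_ ch']; rewrite /zigzag_rank ch'.
  rewrite [X in _ + X + _](eq_bigr (fun=> #|V| - (enum_rank g).+1)); last first.
    by move=> h' /andP[_ ch']; rewrite /zigzag_rank (negPf ch').
  rewrite !sum_nat_cond_const ?cardc.1 ?cardc.2 -mulnDr addnC -mulnS -addSn.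
  by rewrite subnKC // ltn_ord.
have -> : \sum_(h' | eH h h') label zigzag (g, h') =
    \sum_(h' | eH h h') (f h' * #|V| + zigzag_rank g h').+1.
  by apply: eq_bigr => h' _; rewrite /label ffunE.
rewrite /weight /label !sum_label big_split /= -big_distrl /=.
have -> : #|[set h' | eH h h']| = 2 * t by exact: regH.
move: rank_sum.
move: #|V| (\sum_(h' | eH h h') _) (\sum_(h' | _) _) => k r s; nia.
Qed.

End ZigzagLabeling.

Theorem theorem6p4 (V W : finType) (eG : rel V) (eH : rel W) (m n t : nat) :
  is_graph eG -> #|V| = m ->
  ~ (exists d, regular eG d) ->
  (exists A : {set V},
    [/\ bipartition eG A, same_degree_on eG A & same_degree_on eG (~: A)]) ->
  is_graph eH -> #|W| = n ->
  regular eH (2 * t) ->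
  (exists c : W -> bool, neighborhood_balanced eH c) ->
  has_lda_labeling eH ->
  has_lda_labeling (lexprod eG eH) /\
  chi_ld (lexprod eG eH) <= 2 * chi_ld eH.
Proof.
move=> [symG irrG nisoG] _ nregG [A [bipA degA degA']] [symH irrH nisoH] _ regH.
move=> [c balH] ldaH; have [[f fP <-] _] := chi_ldP ldaH.
have /and3P[/injectiveP f_inj _ /forallP f_lda] := fP.
(* The ends of an edge lie on opposite sides, so every vertex shares its side, hence its degree,
   with one of them. Equal degrees at both ends would make [G] regular. *)
have deg_edge u v : eG u v ->
    [/\ degree eG u != degree eG v
      & forall w, (degree eG w == degree eG u) || (degree eG w == degree eG v)].
  move=> /bipA uv.
  have cover w : (degree eG w == degree eG u) || (degree eG w == degree eG v).
    have [wu|wu] := eqVneq (w \in A) (u \in A).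
      have [uA|uA] := boolP (u \in A).
        by rewrite (degA w u) ?eqxx // wu.
      by rewrite (degA' w u) ?eqxx // !inE ?wu.
    have wv : (w \in A) = (v \in A) by move: uv wu; do 3!case: (_ \in A).
    have [vA|vA] := boolP (v \in A).
      by rewrite (degA w v) ?eqxx ?orbT // wv.
    by rewrite (degA' w v) ?eqxx ?orbT // !inE ?wv.
  split=> //; apply/eqP => duv; apply: nregG; exists (degree eG u) => w.
  by have := cover w; rewrite -duv orbb => /eqP.
(* A graph without vertices would be vacuously regular. *)
have [g0 _|V0] := pickP (@predT V); last first.
  by case: nregG; exists 0 => u; have := V0 u.
have [g1 g01] := nisoG g0.
have V_gt0 : 0 < #|V| by apply/card_gt0P; exists g0.
have t2_gt0 (h : W) : 0 < 2 * t.
  have [h' hh'] := nisoH h.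
  by rewrite -(regH h) card_gt0; apply/set0Pn; exists h'; rewrite inE.
pose F := zigzag V c f.
pose P h := \sum_(h' | eH h h') label F (g0, h').
pose S := \sum_h label F (g0, h).
have PE h : P h = #|V| * weight eH f h + t * #|V|.+1 - 2 * t * #|V|.
  by rewrite -(zigzag_copy_weight f g0 h regH balH) addnK.
have copyP g h : \sum_(h' | eH h h') label F (g, h') = P h.
  by rewrite PE -(zigzag_copy_weight f g h regH balH) addnK.
have P_inj h h' : P h = P h' -> weight eH f h = weight eH f h'.
  (* This restores the subtraction-free affine form, whose slope [#|V|] is positive. *)
  move/(congr1 (addn^~ (2 * t * #|V|))).
  rewrite /P !zigzag_copy_weight // => /addIn /eqP.
  by rewrite eqn_pmul2l // => /eqP.
have copyS g : \sum_h label F (g, h) = S.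
  (* Each label of copy [u] is counted once per neighbor of [h'], and the left side does not depend
     on [u]. *)
  have count u : \sum_h P h = \sum_h' label F (u, h') * (2 * t).
    under eq_bigr do rewrite -(copyP u).
    rewrite (exchange_big_dep predT) //=; apply: eq_bigr => h' _.
    rewrite sum_nat_const -(regH h') mulnC; congr (_ * _).
    by rewrite /degree cardsE; apply: eq_card => h; rewrite unfold_in /= symH.
  have := count g; rewrite (count g0) -!big_distrl /= => /eqP.
  (* Cancelling [2 * t] takes a vertex of [H]; without one, both sums are empty. *)
  have [h _|W0] := pickP (@predT W).
    by rewrite eqn_pmul2r ?(t2_gt0 h) // => /eqP.
  by move=> _; rewrite /S !big_pred0.
have weightF g h : weight (lexprod eG eH) F (g, h) = degree eG g * S + P h.
  rewrite weight_lexprod // copyP (eq_bigr (fun=> S)) => [|g' _]; last exact: copyS.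
  by rewrite sum_nat_const /degree cardsE.
have P_gt0 h : 0 < P h.
  by have [h' hh'] := nisoH h; rewrite /P (bigD1 h').
have P_le h : P h <= S by rewrite /S (bigID (eH h)) leq_addr.
have lt_weight d d' h h' : d < d' -> d * S + P h < d' * S + P h'.
  (* The chain is [d * S + P h <= d.+1 * S <= d' * S < d' * S + P h']. *)
  move=> dd'; apply: (@leq_ltn_trans (d' * S)).
    apply: leq_trans (_ : d.+1 * S <= _); last by rewrite leq_mul2r dd' orbT.
    by rewrite mulSn addnC leq_add2r.
  by rewrite -[X in X < _]addn0 ltn_add2l.
have F_inj : injective F by apply: zigzag_inj.
have F_lda : local_distance_antimagic (lexprod eG eH) F.
  apply/and3P; split; first exact/injectiveP.
    apply/forallP => i; apply: inj_card_onto => //.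
    by rewrite card_ord.
  apply/forallP => -[g h]; apply/forallP => -[g' h'].
  apply/implyP; rewrite !weightF => /orP[/= gg'|/andP[/= /eqP<- hh']].
    have [dgg' _] := deg_edge _ _ gg'.
    by move: dgg'; rewrite !neq_ltn => /orP[] /lt_weight->; rewrite ?orbT.
  rewrite eqn_add2l; apply/eqP => /P_inj /eqP; apply/negP.
  by have /forallP/(_ h')/implyP := f_lda h; apply.
have ldaF : has_lda_labeling (lexprod eG eH) by exists F.
split=> //; have [_ /(_ F F_lda) le_chi] := chi_ldP ldaF.
apply: leq_trans le_chi _; rewrite /num_weights.
pose wH := undup [seq weight eH f u | u : W].
pose Pw w := #|V| * w + t * #|V|.+1 - 2 * t * #|V|.
(* Every weight comes from a pair: one of the two degrees at the ends of the fixed edge, and a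
   weight of [H]. *)
rewrite -(size_allpairs (fun d w => d * S + Pw w) [:: degree eG g0; degree eG g1] wH).
apply: uniq_leq_size (undup_uniq _) _ => x; rewrite mem_undup => /imageP[[g h] _ ->].
rewrite weightF PE; apply/allpairsP; exists (degree eG g, weight eH f h); split=> //=.
  by have [_ /(_ g)] := deg_edge _ _ g01; rewrite !inE.
by rewrite mem_undup; apply/imageP; exists h.
Qed.
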